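(* Let $N\ge0$ and $\mathbf{X}:[0,T]\to T^N_\omega(A)$. Then $\mathbf{X}$ is an $N$-sqgrp if and only if $\hat{\mathbf{X}}:=\Phi_H^*\mathbf{X}$ is a weighted $N$-sgrp. Conversely, a path $\hat{\mathbf{X}}:[0,T]\to T^N_\omega(A)$ is a weighted $N$-sgrp if and only if $\mathbf{X}:=\Psi_H^*\hat{\mathbf{X}}$ is an $N$-sqgrp. The same holds for $N$-sqgrms (versus weighted $N$-sgrms), sqgrps (versus weighted sgrps) and sqgrms (versus weighted sgrms), with $\Phi_H^*,\Psi_H^*$ applied pointwise.
   Context: Alphabet $A$ with commutative bracket $\{\cdot,\cdot\}$ on $A\cup\{0\}$ ($\{a,0\}=0$, commutative, associative) and weight $\omega:A\to\{1,2,\dots\}$ with $\omega(\{a,b\})=\omega(a)+\omega(b)$ when $\{a,b\}\ne0$; $A$ has finitely many letters of each weight. Words $w=a_1\cdots a_n$ (incl. empty word $\mathbf{1}$), $\|w\|=\sum\omega(a_i)$, $\{a_1\cdots a_n\}$ the iterated bracket. $T_\omega(A)$: polynomials in words; $T_\omega((A))$: formal series; $\langle x,w\rangle$ coefficient of $w$; $\otimes$ concatenation. $T^N_\omega(A)$: span of words with $\|w\|\le N$, quotient algebra with product $\otimes_{N,\omega}$. Shuffle $\sqcup\!\sqcup$ and quasi-shuffle $\widehat{\sqcup\!\sqcup}$: bilinear, unit $\mathbf{1}$, $va\,\widehat{\sqcup\!\sqcup}\,wb=(v\,\widehat{\sqcup\!\sqcup}\,wb)a+(va\,\widehat{\sqcup\!\sqcup}\,w)b+(v\,\widehat{\sqcup\!\sqcup}\,w)\{a,b\}$,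 shuffle without the last term. Hoffman adjoint maps $\Phi^*_H,\Psi^*_H$: multiplicative on words (w.r.t. concatenation), $\Phi^*_H(a)=\sum_{n\ge1}\sum_{\{a_1\cdots a_n\}=a}\frac1{n!}a_1\cdots a_n$, $\Psi^*_H(a)=\sum_{n\ge1}\sum_{\{a_1\cdots a_n\}=a}\frac{(-1)^{n-1}}{n}a_1\cdots a_n$, extended linearly and coordinatewise to series; they preserve $\|\cdot\|$ (so act on $T^N_\omega(A)$). $N$-sqgrp: non-zero path $\mathbf{X}:[0,T]\to T^N_\omega(A)$ with $\langle\mathbf{X}_t,v\,\widehat{\sqcup\!\sqcup}\,w\rangle=\langle\mathbf{X}_t,v\rangle\langle\mathbf{X}_t,w\rangle$ for all $t$ and words with $\|v\|+\|w\|\le N$, and $t\mapsto\langle\mathbf{X}_t,w\rangle$ smooth for $\|w\|\le N$. $N$-sqgrm: non-zero map $[0,T]^2\to T^N_\omega(A)$ with this relation for each $\mathbf{X}_{s,t}$, $\mathbf{X}_{s,u}\otimes_{N,\omega}\mathbf{X}_{u,t}=\mathbf{X}_{s,t}$, and $t\mapsto\langle\mathbf{X}_{s,t},w\rangle$ smooth. sqgrp/sqgrm: same with values in $T_\omega((A))$, all words, and $\otimes$. Weighted ($N$-)sgrp/sgrm: the same definitions with $\sqcup\!\sqcup$ in place of $\widehat{\sqcup\!\sqcup}$. *)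

(* Defs.v *)
From HB Require Import structures.
From mathcomp Require Import all_boot all_order all_algebra.
From mathcomp Require Import all_classical all_reals all_analysis.
Set Implicit Arguments. Unset Strict Implicit. Unset Printing Implicit Defensive.
Import Order.TTheory GRing.Theory Num.Theory.
Local Open Scope ring_scope.

(* Weighted alphabet with a commutative, associative bracket on A ∪ {0}.
   [None] plays the role of 0.  [letters k] lists (without repetition)
   all the letters of weight k (A has finitely many letters of each weight). *)
Record walphabet := WAlphabet {
  letter : eqType;
  br : letter -> letter -> option letter;
  wt : letter -> nat;
  letters : nat -> seq letter;
  br_comm : forall a b, br a b = br b a;
  br_assoc : forall a b c,
      obind (br a) (br b c) = obind (fun d => br d c) (br a b);
  wt_pos : forall a, (0 < wt a)%N;
  wt_br : forall a b c, br a b = Some c -> wt c = (wt a + wt b)%N;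
  letters_uniq : forall k, uniq (letters k);
  letters_spec : forall k a, (a \in letters k) = (wt a == k)
}.

Section Words.
Variable Al : walphabet.
Local Notation A := (letter Al).
Local Notation word := (seq A).

Definition wword (w : word) : nat := sumn (map (@wt Al) w).

Fixpoint ibr (w : word) : option A :=
  match w with
  | [::] => None
  | a :: w' => match w' with
               | [::] => Some a
               | _ => obind (br a) (ibr w')
               end
  end.

Definition lets_upto (n : nat) : seq A := flatten [seq letters Al k | k <- iota 1 n].
Fixpoint wlen (L : seq A) (m : nat) : seq word :=
  match m with
  | 0 => [:: [::]]
  | m'.+1 => [seq a :: w | a <- L, w <- wlen L m']
  end.
Definition words_wt (n : nat) : seq word :=
  [seq w <- flatten [seq wlen (lets_upto n) m | m <- iota 0 n.+1] | wword w == n].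

(* Polynomials with natural (multiplicity) coefficients are represented as
   lists of words; [quasi-]shuffle on reversed words (recursion on last letters). *)
Fixpoint qshr (b : A -> A -> option A) (x : word) : word -> seq word :=
  match x with
  | [::] => fun y => [:: y]
  | a :: x' =>
      fix inner (y : word) : seq word :=
        match y with
        | [::] => [:: a :: x']
        | c :: y' =>
            map (cons a) (qshr b x' (c :: y')) ++ map (cons c) (inner y') ++
            (if b a c is Some d then map (cons d) (qshr b x' y') else [::])
        end
  end.

Definition qsh (v w : word) : seq word := map rev (qshr (@br Al) (rev v) (rev w)).
Definition sh (v w : word) : seq word := map rev (qshr (fun _ _ => None) (rev v) (rev w)).

End Words.

Section Series.
Variable R : realType.
Variable Al : walphabet.
Local Notation A := (letter Al).
Local Notation word := (seq A).

Definition wseries := word -> R.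

Definition pairing (x : wseries) (P : seq word) : R := \sum_(u <- P) x u.

Definition in_TN (N : nat) (x : wseries) : Prop :=
  forall w, (N < wword w)%N -> x w = 0.

(* truncated concatenation product ⊗_{N,ω} (for ||w|| <= N) / full product *)
Definition tprod (x y : wseries) : wseries :=
  fun w => \sum_(i < (size w).+1) x (take i w) * y (drop i w).

Definition rpoly := seq (R * word).
Definition rcoef (P : rpoly) (u : word) : R :=
  \sum_(p <- P) (if p.2 == u then p.1 else 0).

(* Hoffman-type adjoint map determined by coefficients c n:
   letter a |-> sum_{n>=1} sum_{ {a_1..a_n} = a } c n a_1...a_n,
   extended multiplicatively on words (concatenation). *)
Definition hletter (c : nat -> R) (a : A) : rpoly :=
  [seq (c (size u), u) | u <- words_wt Al (wt a) & ibr u == Some a].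
Definition hword (c : nat -> R) (w : word) : rpoly :=
  foldr (fun a P => [seq (p.1 * q.1, p.2 ++ q.2) | p <- hletter c a, q <- P])
        [:: (1, [::])] w.
(* extension to wseries: H x = sum_w <x,w> H(w); only words of the same
   weight contribute since H preserves weight. *)
Definition hseries (c : nat -> R) (x : wseries) : wseries :=
  fun u => \sum_(w <- words_wt Al (wword u)) x w * rcoef (hword c w) u.

Definition phi_coef (n : nat) : R := (n`!)%:R^-1.
Definition psi_coef (n : nat) : R := (-1) ^+ n.-1 / n%:R.
Definition PhiH : wseries -> wseries := hseries phi_coef.
Definition PsiH : wseries -> wseries := hseries psi_coef.

Definition smooth_on (T : R) (f : R -> R) : Prop :=
  exists g : R -> R, (forall n x, derivable (derive1n n g) x 1) /\
                     (forall t, 0 <= t <= T -> f t = g t).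

Definition charN (prod : word -> word -> seq word) (N : nat) (x : wseries) : Prop :=
  forall v w, (wword v + wword w <= N)%N -> pairing x (prod v w) = x v * x w.
Definition char_full (prod : word -> word -> seq word) (x : wseries) : Prop :=
  forall v w, pairing x (prod v w) = x v * x w.

Definition nonzeroN (N : nat) (x : wseries) : Prop := exists w, (wword w <= N)%N /\ x w <> 0.
Definition nonzero (x : wseries) : Prop := exists w, x w <> 0.

Definition Ngrp (prod : word -> word -> seq word) (N : nat) (T : R) (X : R -> wseries) :=
  (forall t, 0 <= t <= T -> nonzeroN N (X t) /\ charN prod N (X t)) /\
  (forall w, (wword w <= N)%N -> smooth_on T (fun t => X t w)).
Definition grp (prod : word -> word -> seq word) (T : R) (X : R -> wseries) :=
  (forall t, 0 <= t <= T -> nonzero (X t) /\ char_full prod (X t)) /\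
  (forall w, smooth_on T (fun t => X t w)).
Definition Ngrm (prod : word -> word -> seq word) (N : nat) (T : R) (X : R -> R -> wseries) :=
  (forall s t, 0 <= s <= T -> 0 <= t <= T -> nonzeroN N (X s t) /\ charN prod N (X s t)) /\
  (forall s u t, 0 <= s <= T -> 0 <= u <= T -> 0 <= t <= T ->
     forall w, (wword w <= N)%N -> tprod (X s u) (X u t) w = X s t w) /\
  (forall s, 0 <= s <= T -> forall w, (wword w <= N)%N -> smooth_on T (fun t => X s t w)).
Definition grm (prod : word -> word -> seq word) (T : R) (X : R -> R -> wseries) :=
  (forall s t, 0 <= s <= T -> 0 <= t <= T -> nonzero (X s t) /\ char_full prod (X s t)) /\
  (forall s u t, 0 <= s <= T -> 0 <= u <= T -> 0 <= t <= T ->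
     forall w, tprod (X s u) (X u t) w = X s t w) /\
  (forall s, 0 <= s <= T -> forall w, smooth_on T (fun t => X s t w)).

Definition Nsqgrp := Ngrp (@qsh Al).
Definition Nsgrp := Ngrp (@sh Al).
Definition sqgrp := grp (@qsh Al).
Definition sgrp := grp (@sh Al).
Definition Nsqgrm := Ngrm (@qsh Al).
Definition Nsgrm := Ngrm (@sh Al).
Definition sqgrm := grm (@qsh Al).
Definition sgrm := grm (@sh Al).

End Series.

(* Main.v *)
(* Words are dual to series, and both Hoffman maps H are algebra morphisms for
   concatenation: H(x (x) y) = H x (x) H y.  Since pairing with a (quasi-)shuffle is
   compatible with deconcatenation as well, the identities
     <Phi x, u sh v> = <x, Phi^t u qsh Phi^t v>   and   Psi (Phi x) = x
   need only be checked for the coefficient functional x of a single letter a.  For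
   the first, a word of length m and one of length n have 'C(m + n, m) shuffles, all
   with the same bracket, which turns 1/(m + n)! into 1/(m! n!).  For the second, the
   coefficient of u is that of X^|u| in exp(log(1 + X)) - 1.  All maps preserve the
   weight, and are finite sums in each weight, so the properties defining rough paths
   and models transfer weight by weight. *)
Require Import Defs.
From HB Require Import structures.
From mathcomp Require Import all_boot all_order all_algebra.
From mathcomp Require Import all_classical all_reals all_analysis.
Import Order.TTheory GRing.Theory Num.Theory.
Local Open Scope ring_scope.
Set Implicit Arguments. Unset Strict Implicit. Unset Printing Implicit Defensive.

(** * Sums over the two-factor splittings of a word *)

Section Deconcatenation.
Variables (T : Type) (V : nmodType).
Implicit Types (G : seq T -> seq T -> V) (u : seq T).

(** The deconcatenation coproduct of [u], paired with [G]. The product [tprod] is the case of a [G]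
    that is a product of two series. *)
Definition dc G u : V := \sum_(i < (size u).+1) G (take i u) (drop i u).

Lemma dc_nil G : dc G [::] = G [::] [::].
Proof. by rewrite /dc big_ord_recl big_ord0 addr0. Qed.

Lemma dc_cons G a u : dc G (a :: u) = G [::] (a :: u) + dc (fun p => G (a :: p)) u.
Proof. by rewrite /dc big_ord_recl. Qed.

Lemma eq_dc G1 G2 u : (forall p q, p ++ q = u -> G1 p q = G2 p q) -> dc G1 u = dc G2 u.
Proof. by move=> e; apply: eq_bigr => i _; apply: e; rewrite cat_take_drop. Qed.

Lemma dcD G1 G2 u : dc (fun p q => G1 p q + G2 p q) u = dc G1 u + dc G2 u.
Proof. exact: big_split. Qed.

Lemma dc_sum (I : Type) (r : seq I) (G : I -> seq T -> seq T -> V) u :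
  dc (fun p q => \sum_(i <- r) G i p q) u = \sum_(i <- r) dc (G i) u.
Proof. exact: exchange_big. Qed.

Lemma dc0 u : dc (fun _ _ => 0) u = 0.
Proof. by rewrite /dc big1. Qed.

(** Both sides sum [G] over the splittings of [u] into three factors. *)
Lemma dc_coassoc (G : seq T -> seq T -> seq T -> V) u :
  dc (fun p q => dc (G p) q) u = dc (fun p q => dc (fun p1 p2 => G p1 p2 q) p) u.
Proof.
elim: u G => [|a u IH] G; first by rewrite !dc_nil.
rewrite !dc_cons dc_nil IH -addrA -dcD; congr (_ + _).
by apply: eq_dc => p q _; rewrite dc_cons.
Qed.

Lemma dc_rev G u : dc G (rev u) = dc (fun p q => G (rev q) (rev p)) u.
Proof.
rewrite /dc size_rev (reindex_inj rev_ord_inj); apply: eq_bigr => i _ /=.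
by rewrite subSS take_rev drop_rev subKn // -ltnS.
Qed.

Lemma dc_left G u : (forall p q, p <> [::] -> G p q = 0) -> dc G u = G [::] u.
Proof.
case: u => [|a u] G0; first by rewrite dc_nil.
rewrite dc_cons (eq_dc (G2 := fun _ _ => 0)) ?dc0 ?addr0 // => p q _.
exact: G0.
Qed.

Lemma dc_right G u : (forall p q, q <> [::] -> G p q = 0) -> dc G u = G u [::].
Proof.
move=> G0; rewrite -[u in LHS]revK dc_rev dc_left ?revK // => p q p0.
by apply: G0 => /(congr1 rev); rewrite revK.
Qed.

End Deconcatenation.

Lemma exchange_dc (S T : Type) (V : nmodType) (G : seq S -> seq S -> seq T -> seq T -> V) u v :
  dc (fun u1 u2 => dc (G u1 u2) v) u =
  dc (fun v1 v2 => dc (fun u1 u2 => G u1 u2 v1 v2) u) v.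
Proof. exact: exchange_big. Qed.

Lemma dcZl (T : Type) (R : pzSemiRingType) (c : R) (G : seq T -> seq T -> R) u :
  dc (fun p q => c * G p q) u = c * dc G u.
Proof. by rewrite /dc mulr_sumr. Qed.

Lemma dcZr (T : Type) (R : pzSemiRingType) (c : R) (G : seq T -> seq T -> R) u :
  dc (fun p q => G p q * c) u = dc G u * c.
Proof. by rewrite /dc mulr_suml. Qed.

(** A splitting is determined by its factors, so the indicator of a concatenation is the convolution
    of two indicators. Multiplicativity of [rcoef] and [delta] rests on this. *)
Lemma dc_eq_cat (T : eqType) (R : pzSemiRingType) (p q u : seq T) :
  dc (fun p' q' => (p == p')%:R * (q == q')%:R) u = (p ++ q == u)%:R :> R.
Proof.
elim: u p => [|a u IH] [|b p].
- by rewrite dc_nil eqxx mul1r.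
- by rewrite dc_nil /= mul0r.
- by rewrite dc_left ?mul1r // => -[|? ?] q0 //= _; rewrite mul0r.
- rewrite dc_cons /= mul0r add0r eqseq_cons.
  have [->|ba] := eqVneq b a.
    by rewrite -IH; apply: eq_dc => x y _; rewrite eqseq_cons eqxx.
  rewrite -[RHS](dc0 R u); apply: eq_dc => x y _.
  by rewrite eqseq_cons (negPf ba) mul0r.
Qed.

Lemma uniq_flatten_map (I T : eqType) (F : I -> seq T) (f : T -> I) (s : seq I) :
  uniq s -> (forall i, uniq (F i)) -> (forall i x, x \in F i -> f x = i) ->
  uniq (flatten [seq F i | i <- s]).
Proof.
move=> us uF fF; elim: s us => //= i s IH /andP[nis us].
rewrite cat_uniq uF IH // andbT /=; apply/hasPn => x /flatten_mapP[j js xj].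
by apply: contra nis => xi; rewrite -(fF _ _ xi) (fF _ _ xj).
Qed.

(** * Weights, enumeration of the words of a given weight, brackets, terms of shuffles *)

Section Words.
Variable Al : walphabet.
Local Notation A := (letter Al).
Local Notation word := (seq A).
Implicit Types (a b : A) (u v w : word).

Lemma wword_cons a w : wword (a :: w) = (wt a + wword w)%N.
Proof. by []. Qed.

Lemma wword_cat u v : wword (u ++ v) = (wword u + wword v)%N.
Proof. by rewrite /wword map_cat sumn_cat. Qed.

Lemma wword_rev w : wword (rev w) = wword w.
Proof. by rewrite /wword map_rev sumn_rev. Qed.

Lemma size_le_wword w : (size w <= wword w)%N.
Proof.
elim: w => //= a w IH.
by rewrite wword_cons -add1n leq_add // wt_pos.
Qed.

Lemma wt_le_wword a w : a \in w -> (wt a <= wword w)%N.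
Proof.
elim: w => //= b w IH; rewrite inE wword_cons => /predU1P[->|/IH]; first exact: leq_addr.
by move=> h; apply: leq_trans h (leq_addl _ _).
Qed.

Lemma lets_upto_uniq n : uniq (lets_upto Al n).
Proof.
apply: (uniq_flatten_map (f := @wt Al)) => [||k a]; first exact: iota_uniq.
- exact: letters_uniq.
- by rewrite letters_spec => /eqP.
Qed.

Lemma mem_lets_upto n a : (a \in lets_upto Al n) = (wt a <= n)%N.
Proof.
apply/flatten_mapP/idP => [[k]|an].
  by rewrite mem_iota letters_spec add1n ltnS => /andP[_ kn] /eqP ->.
by exists (wt a); rewrite ?letters_spec // mem_iota wt_pos add1n ltnS.
Qed.

Lemma mem_wlen (L : seq A) m w : (w \in wlen L m) = (size w == m) && all (mem L) w.
Proof.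
elim: m w => [|m IH] [|a w] //=.
- by apply/allpairsPdep => -[? [? [_ _]]].
- rewrite eqSS; apply/allpairsPdep/and3P => [[b [v [bL vm [-> ->]]]]|[sw aL wL]].
    by move: vm; rewrite IH => /andP[-> ->].
  by exists a, w; rewrite IH sw.
Qed.

Lemma wlen_uniq (L : seq A) m : uniq L -> uniq (wlen L m).
Proof.
by move=> uL; elim: m => //= m IH; apply: allpairs_uniq => // -[a w] [b v] _ _ [-> ->].
Qed.

Lemma words_wt_uniq n : uniq (words_wt Al n).
Proof.
apply/filter_uniq/(uniq_flatten_map (f := size)) => [||m w]; first exact: iota_uniq.
- by move=> m; apply/wlen_uniq/lets_upto_uniq.
- by rewrite mem_wlen => /andP[/eqP].
Qed.

Lemma mem_words_wt n w : (w \in words_wt Al n) = (wword w == n).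
Proof.
rewrite mem_filter; case: eqP => // <-; rewrite andTb; apply/flatten_mapP.
exists (size w); first by rewrite mem_iota ltnS size_le_wword.
by rewrite mem_wlen eqxx; apply/allP => a /wt_le_wword; rewrite /= mem_lets_upto.
Qed.

(* [None] is the unit (the bracket of the empty word) and [Some None] is 0. *)
Definition obr (x y : option (option A)) : option (option A) :=
  match x, y with
  | None, _ => y
  | _, None => x
  | Some x', Some y' => Some (obind (fun a => obind (br a) y') x')
  end.

Lemma obrA : associative obr.
Proof.
move=> [[a|]|] [[b|]|] [[c|]|] //=; first by rewrite br_assoc.
by case: (br a b).
Qed.

Lemma obrC : commutative obr.
Proof. by move=> [[a|]|] [[b|]|] //=; rewrite br_comm. Qed.

Lemma obr0x : left_id None obr.
Proof. by []. Qed.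

HB.instance Definition _ :=
  Monoid.isComLaw.Build (option (option A)) None obr obrA obrC obr0x.

(** A form of [ibr] valued in a commutative monoid, hence compatible with concatenation and
    permutation. The empty word gets the unit here, whereas [ibr] sends it to 0. *)
Definition wbr w : option (option A) := \big[obr/None]_(a <- w) Some (Some a).

Lemma wbr_cons a w : wbr (a :: w) = obr (Some (Some a)) (wbr w).
Proof. exact: big_cons. Qed.

Lemma wbr_cat u v : wbr (u ++ v) = obr (wbr u) (wbr v).
Proof. exact: big_cat. Qed.

Lemma wbr_perm u v : perm_eq u v -> wbr u = wbr v.
Proof. exact: perm_big. Qed.

Lemma wbrE w : wbr w = if w is [::] then None else Some (ibr w).
Proof.
elim: w => [|a [|b w] IH]; first exact: big_nil.
  by rewrite wbr_cons IH.
by rewrite wbr_cons IH /=.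
Qed.

Lemma wbr_ibr w a : (wbr w == Some (Some a)) = (ibr w == Some a).
Proof. by rewrite wbrE; case: w. Qed.

Lemma ibr_wt w a : ibr w = Some a -> wword w = wt a.
Proof.
elim: w a => // b [|c w] IH a; first by case=> <-; rewrite wword_cons addn0.
rewrite -[ibr _]/(obind (br b) (ibr (c :: w))); case E: (ibr (c :: w)) => [d|] //= bd.
by rewrite wword_cons (IH d E) (wt_br bd).
Qed.

Lemma qshr_perm x y s : s \in qshr (fun _ _ : A => None) x y -> perm_eq s (x ++ y).
Proof.
elim: x y s => [|a x IHx] y s; first by rewrite inE => /eqP ->.
elim: y s => [|c y IHy] s; first by rewrite inE cats0 => /eqP ->.
rewrite [qshr _ _ _]/= cats0 mem_cat => /orP[] /mapP[t ht ->].
  by rewrite /= perm_cons IHx.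
by rewrite -[c :: y]cat1s perm_sym perm_catCA perm_sym perm_cons IHy.
Qed.

Lemma qshr_wword (f : A -> A -> option A) x y s :
  (forall a b c, f a b = Some c -> wt c = wt a + wt b)%N ->
  s \in qshr f x y -> wword s = (wword x + wword y)%N.
Proof.
move=> fwt; elim: x y s => [|a x IHx] y s; first by rewrite inE => /eqP ->.
elim: y s => [|c y IHy] s; first by rewrite inE addn0 => /eqP ->.
rewrite [qshr _ _ _]/= !mem_cat => /or3P[/mapP[t ht ->]|/mapP[t ht ->]|].
- by rewrite wword_cons (IHx _ _ ht) wword_cons addnA.
- by rewrite wword_cons (IHy _ ht) !wword_cons addnCA.
- case E: (f a c) => [d|] // /mapP[t ht ->].
  by rewrite !wword_cons (IHx _ _ ht) (fwt _ _ _ E) addnACA.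
Qed.

Lemma qsh_wword v w s : s \in qsh v w -> wword s = (wword v + wword w)%N.
Proof.
case/mapP => t ht ->; rewrite wword_rev (qshr_wword _ ht) ?wword_rev //.
exact: wt_br.
Qed.

Lemma sh_wword v w s : s \in sh v w -> wword s = (wword v + wword w)%N.
Proof. by case/mapP => t ht ->; rewrite wword_rev (qshr_wword _ ht) ?wword_rev. Qed.

Lemma sh_perm v w s : s \in sh v w -> perm_eq s (v ++ w).
Proof.
case/mapP => t ht ->; rewrite perm_rev perm_sym perm_catC -perm_rev rev_cat.
by rewrite perm_sym qshr_perm.
Qed.

(** Without a bracket term, the recursion of the shuffle is Pascal's rule; lists count the shuffles
    with multiplicity. *)
Lemma size_qshr_shuffle (x y : word) :
  size (qshr (fun _ _ => None) x y) = 'C(size x + size y, size x).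
Proof.
elim: x y => [|a x IHx] y; first by rewrite bin0.
elim: y => [|c y IHy]; first by rewrite addn0 binn.
rewrite [qshr _ _ _]/= cats0 size_cat !size_map IHx IHy /= addSn binS addnC.
by rewrite !addnS.
Qed.

Lemma size_sh v w : size (sh v w) = 'C(size v + size w, size v).
Proof. by rewrite size_map size_qshr_shuffle !size_rev. Qed.

End Words.

(** * Hoffman maps: recursion on the first letter and multiplicativity *)

Section Hoffman.
Variables (R : realType) (Al : walphabet).
Local Notation A := (letter Al).
Local Notation word := (seq A).
Implicit Types (a b : A) (u v w p q : word) (x y : wseries R Al) (c : nat -> R).

Lemma tprodE x y : tprod x y = dc (fun p q => x p * y q).
Proof. by []. Qed.

Lemma sum_words_wt_delta (F : word -> R) n u : wword u = n ->
  \sum_(w <- words_wt Al n) F w * (w == u)%:R = F u.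
Proof.
move=> un; rewrite (bigD1_seq u) ?mem_words_wt ?un ?words_wt_uniq //= eqxx mulr1.
by rewrite big1 ?addr0 // => w /negPf ->; rewrite mulr0.
Qed.

Lemma rcoef_cat_allpairs (P Q : rpoly R Al) :
  rcoef [seq (i.1 * j.1, i.2 ++ j.2) | i <- P, j <- Q] = tprod (rcoef P) (rcoef Q).
Proof.
apply/funext => u; rewrite tprodE /rcoef big_allpairs_dep /=.
rewrite [RHS](eq_dc (fun p q _ => mulr_suml _ _ _ _)) dc_sum; apply: eq_bigr => i _.
rewrite [RHS](eq_dc (fun p q _ => mulr_sumr _ _ _ _)) dc_sum; apply: eq_bigr => j _.
transitivity (i.1 * j.1 * (i.2 ++ j.2 == u)%:R).
  by case: eqP => _; rewrite ?mulr1 ?mulr0.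
rewrite -dc_eq_cat -dcZl; apply: eq_dc => p q _.
by case: eqP => _; case: eqP => _; rewrite ?(mulr0, mulr1, mul0r, mul1r).
Qed.

(** The restriction to words of weight [wt a] loses nothing, because a nonzero bracket has the
    weight of its word. *)
Lemma rcoef_hletter c a u :
  rcoef (hletter c a) u = (ibr u == Some a)%:R * c (size u).
Proof.
rewrite /rcoef big_map big_filter /=.
under eq_bigr => i _.
  rewrite (_ : (if _ then _ else _) = c (size i) * (i == u)%:R); last first.
    by case: eqP; rewrite ?mulr1 ?mulr0.
  over.
rewrite big_mkcond /=.
under eq_bigr => i _.
  rewrite (_ : (if _ then _ else _) = (ibr i == Some a)%:R * c (size i) * (i == u)%:R); last first.
    by case: eqP; rewrite ?(mul1r, mul0r).
  over.
have [ua|ua] := eqVneq (ibr u) (Some a).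
  by rewrite sum_words_wt_delta ?ua ?eqxx //; exact: ibr_wt.
rewrite mul0r big1 // => i _; have [->|_] := eqVneq i u; last by rewrite mulr0.
by rewrite (negPf ua) !mul0r.
Qed.

Lemma rcoef_hword_nil c u : rcoef (hword c [::]) u = (u == [::])%:R.
Proof.
by rewrite /rcoef /hword /= big_cons big_nil addr0 eq_sym; case: eqP.
Qed.

Lemma rcoef_hword_cons c a w :
  rcoef (hword c (a :: w)) = tprod (rcoef (hletter c a)) (rcoef (hword c w)).
Proof. exact: rcoef_cat_allpairs. Qed.

(** This locality in the weight lets the truncated and the full statements share all later
    arguments. *)
Lemma hseries_local c x y n : (forall w, wword w = n -> x w = y w) ->
  forall u, wword u = n -> hseries c x u = hseries c y u.
Proof.
move=> xy u un; rewrite /hseries !big_seq; apply: eq_bigr => w.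
by rewrite mem_words_wt un => /eqP/xy ->.
Qed.

Lemma hseriesD c x y u :
  hseries c (fun w => x w + y w) u = hseries c x u + hseries c y u.
Proof. by rewrite /hseries -big_split; apply: eq_bigr => w _; rewrite mulrDl. Qed.

Lemma hseriesZ c (k : R) x u : hseries c (fun w => k * x w) u = k * hseries c x u.
Proof. by rewrite /hseries mulr_sumr; apply: eq_bigr => w _; rewrite mulrA. Qed.

Lemma hseries_sum c (I : Type) (r : seq I) (F : I -> wseries R Al) u :
  hseries c (fun w => \sum_(i <- r) F i w) u = \sum_(i <- r) hseries c (F i) u.
Proof.
rewrite /hseries exchange_big; apply: eq_bigr => w _; exact: mulr_suml.
Qed.

(** The contribution to the coefficient of [p ++ q] from source words whose first letter yields [p]
    and whose other letters yield [q]; that first letter can only be the bracket of [p]. *)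
Definition hstep c x p q : R :=
  if ibr p is Some b then c (size p) * hseries c (fun w => x (b :: w)) q else 0.

Lemma sum_words_wt_cons (F : word -> R) n b :
  \sum_(w <- words_wt Al (wt b + n)) (if w is a :: w' then (a == b)%:R * F w' else 0)
  = \sum_(w <- words_wt Al n) F w.
Proof.
rewrite -[RHS](big_map (cons b) predT (fun w => F (behead w))).
rewrite [RHS](perm_big [seq w <- words_wt Al (wt b + n) | ohead w == Some b]); last first.
  apply: uniq_perm; first by rewrite map_inj_uniq ?words_wt_uniq // => ? ? [].
    exact/filter_uniq/words_wt_uniq.
  move=> w; rewrite mem_filter mem_words_wt; apply/mapP/andP => [[v + ->]|[]].
    by rewrite mem_words_wt wword_cons => /eqP ->; rewrite !eqxx.
  case: w => // a w /eqP[->]; rewrite wword_cons eqn_add2l => h.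
  by exists w; rewrite ?mem_words_wt.
rewrite [RHS]big_filter [RHS]big_mkcond; apply: eq_bigr => -[|a w] _ //=.
rewrite (_ : (Some a == Some b) = (a == b)) //.
by case: eqP; rewrite ?mul1r ?mul0r.
Qed.

(** The source word is either empty or has a first letter, whose image is some prefix [p] of [u]. *)
Lemma hseries_rec c x u :
  hseries c x u = x [::] * (u == [::])%:R + dc (hstep c x) u.
Proof.
have KE w : rcoef (hword c w) u = (w == [::])%:R * (u == [::])%:R +
    dc (fun p q => if ibr p is Some b then c (size p) *
      (if w is a :: w' then (a == b)%:R * rcoef (hword c w') q else 0) else 0) u.
  case: w => [|a w].
    rewrite rcoef_hword_nil mul1r (eq_dc (G2 := fun _ _ => 0)) ?dc0 ?addr0 // => p q _.
    by case: (ibr p) => // b; rewrite mulr0.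
  rewrite mul0r add0r rcoef_hword_cons tprodE; apply: eq_dc => p q _.
  rewrite rcoef_hletter; case: (ibr p) => [b|]; last by rewrite !mul0r.
  rewrite (_ : (Some b == Some a) = (a == b)); last by rewrite eq_sym.
  by rewrite mulrA; congr (_ * _); rewrite mulrC.
rewrite /hseries; under eq_bigr => w _ do rewrite KE mulrDr -dcZl.
rewrite big_split /= -dc_sum; congr (_ + _).
  have [->|u0] := eqVneq u [::].
    by under eq_bigr => w _ do rewrite mulr1; rewrite sum_words_wt_delta ?mulr1.
  by rewrite mulr0 big1 // => w _; rewrite !mulr0.
apply: eq_dc => p q pq; rewrite /hstep; case E: (ibr p) => [b|]; last first.
  by rewrite big1 // => w _; rewrite mulr0.
(* Since [b] has the weight of [p], the source words starting with [b] are those of the weight of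
   [q] with [b] put in front. *)
rewrite -pq wword_cat (ibr_wt E) /hseries -[in RHS](sum_words_wt_cons _ _ b) mulr_sumr.
apply: eq_bigr => -[|a w] _; first by rewrite !mulr0.
by case: eqP => [->|_]; rewrite ?(mul0r, mulr0) // !mul1r mulrCA.
Qed.

Lemma hseries_delta_nil c u :
  hseries c (fun w => (w == [::])%:R) u = (u == [::])%:R.
Proof.
rewrite hseries_rec eqxx mul1r -[RHS]addr0; congr (_ + _).
rewrite -[RHS](dc0 R u); apply: eq_dc => p q _; rewrite /hstep.
case: (ibr p) => // b; rewrite /hseries big1 ?mulr0 // => v _; exact: mul0r.
Qed.

Lemma hseries_tprod c x y u :
  hseries c (tprod x y) u = tprod (hseries c x) (hseries c y) u.
Proof.
(* The empty word has no bracket, so each contributing prefix is nonempty and the remaining suffix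
   is shorter. The series [x] varies, as the recursion strips a letter from its argument. *)
have [n] := ubnP (size u); elim: n x u => // n IH x u un.
rewrite hseries_rec !tprodE dc_nil.
(* The first source letter belongs either to the factor of [y], when [x] contributes [x [::]], or to
   the factor of [x]. *)
transitivity (x [::] * hseries c y u +
  dc (fun p q => dc (fun q1 q2 => hstep c x p q1 * hseries c y q2) q) u).
  rewrite [hseries c y u]hseries_rec mulrDr mulrA -addrA; congr (_ + _).
  rewrite -dcZl -dcD; apply: eq_dc => p q pq.
  rewrite /hstep; case E: (ibr p) => [b|]; last first.
    by rewrite mulr0 add0r -[LHS](dc0 R q); apply: eq_dc => *; rewrite mul0r.
  rewrite (_ : (fun w => _) =
    fun w => x [::] * y (b :: w) + tprod (fun v => x (b :: v)) y w); last first.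
    by apply/funext => w; rewrite dc_cons.
  rewrite hseriesD hseriesZ mulrDr mulrCA; congr (_ + _).
  rewrite IH ?tprodE; last first.
    move: un; rewrite -pq size_cat; case: (p) E => //= ? p' _.
    by rewrite addSn ltnS; apply: leq_ltn_trans; rewrite leq_addl.
  by rewrite -dcZl; apply: eq_dc => *; rewrite mulrA.
rewrite dc_coassoc; under [RHS]eq_dc => p q _ do rewrite hseries_rec mulrDl.
rewrite dcD; congr (_ + _).
  rewrite dc_left ?eqxx ?mulr1 // => p q /eqP/negPf ->.
  by rewrite mulr0 mul0r.
by apply: eq_dc => p q _; rewrite dcZr.
Qed.

(** * Compatibility of quasi-shuffles with deconcatenation *)

Section Qshr.
Variable f : A -> A -> option A.

Lemma pairing_qshr_cons x a b v w :
  pairing x (qshr f (a :: v) (b :: w)) =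
  pairing (fun s => x (a :: s)) (qshr f v (b :: w)) +
  pairing (fun s => x (b :: s)) (qshr f (a :: v) w) +
  (if f a b is Some d then pairing (fun s => x (d :: s)) (qshr f v w) else 0).
Proof.
rewrite [qshr _ _ _]/= /pairing !big_cat /= !big_map addrA; congr (_ + _).
by case: (f a b) => [d|]; rewrite ?big_map ?big_nil.
Qed.

Lemma pairing1 x w : pairing x [:: w] = x w.
Proof. by rewrite /pairing big_seq1. Qed.

Lemma qshr_nil v : qshr f v [::] = [:: v].
Proof. by case: v. Qed.

Lemma pairing_tprod_cons x y a (P : seq word) :
  pairing (fun s => tprod x y (a :: s)) P =
  x [::] * pairing (fun s => y (a :: s)) P + pairing (tprod (fun s => x (a :: s)) y) P.
Proof.
rewrite /pairing mulr_sumr -big_split; apply: eq_bigr => s _.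
by rewrite tprodE dc_cons.
Qed.

(** The bialgebra property of the quasi-shuffle. Both [qshr] and [dc] peel off first letters, so a
    double induction applies; taking [f] arbitrary covers the shuffle as well. *)
Lemma pairing_tprod_qshr x y v w :
  pairing (tprod x y) (qshr f v w) =
  dc (fun v1 v2 => dc (fun w1 w2 =>
    pairing x (qshr f v1 w1) * pairing y (qshr f v2 w2)) w) v.
Proof.
elim: v x w => [|a v IHv] x w.
  by rewrite dc_nil /= pairing1 tprodE; apply: eq_dc => *; rewrite !pairing1.
elim: w x => [|b w IHw] x.
  rewrite pairing1 tprodE; apply: eq_dc => v1 v2 _.
  by rewrite dc_nil !qshr_nil !pairing1.
rewrite pairing_qshr_cons !pairing_tprod_cons IHv IHw.
rewrite (_ : (if f a b is Some d then _ else 0) =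
  x [::] * (if f a b is Some d then pairing (fun s => y (d :: s)) (qshr f v w) else 0)
  + dc (fun v1 v2 => dc (fun w1 w2 =>
    (if f a b is Some d then pairing (fun s => x (d :: s)) (qshr f v1 w1) else 0)
     * pairing y (qshr f v2 w2)) w) v); last first.
  case: (f a b) => [d|]; first by rewrite pairing_tprod_cons IHv.
  rewrite mulr0 add0r -[LHS](dc0 R v); apply: eq_dc => v1 v2 _.
  by rewrite -[LHS](dc0 R w); apply: eq_dc => *; rewrite mul0r.
have addACA3 (k1 l1 k2 l2 k3 l3 : R) :
    k1 + l1 + (k2 + l2) + (k3 + l3) = k1 + k2 + k3 + (l1 + l2 + l3).
  by rewrite [k1 + l1 + _]addrACA [LHS]addrACA.
(* The terms with factor [x [::]] recombine into the splitting whose two prefixes are empty. The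
   others are sorted by which of the two prefixes is empty. *)
rewrite addACA3 -!mulrDr -pairing_qshr_cons.
rewrite [RHS]dc_cons [in RHS]dc_cons pairing1 -[RHS]addrA; congr (_ + _).
rewrite [X in _ + X + _]dc_cons [X in X + _]addrCA -!addrA; congr (_ + _).
  by apply: eq_dc => *; rewrite !pairing1.
rewrite -!dcD; apply: eq_dc => v1 v2 _.
rewrite !dc_cons !qshr_nil !pairing1 -addrA; congr (_ + _).
rewrite -!dcD; apply: eq_dc => w1 w2 _.
by rewrite pairing_qshr_cons !mulrDl addrA.
Qed.

End Qshr.

Lemma tprod_rev x y : (fun s => tprod x y (rev s)) =
  tprod (fun s => y (rev s)) (fun s => x (rev s)).
Proof.
by apply/funext => s; rewrite !tprodE dc_rev; apply: eq_dc => *; rewrite mulrC.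
Qed.

Lemma pairing_rev x (P : seq word) : pairing x (map rev P) = pairing (fun s => x (rev s)) P.
Proof. by rewrite /pairing big_map. Qed.

(** Reversal swaps the factors both of [tprod] and of each splitting, so the two swaps cancel. [Q]
    unifies with [qsh] and with [sh]. *)
Lemma pairing_tprod_rev_qshr (f : A -> A -> option A) x y v w
    (Q := fun v w => map rev (qshr f (rev v) (rev w))) :
  pairing (tprod x y) (Q v w) = dc (fun v1 v2 => dc (fun w1 w2 =>
    pairing x (Q v1 w1) * pairing y (Q v2 w2)) w) v.
Proof.
rewrite pairing_rev tprod_rev pairing_tprod_qshr dc_rev; apply: eq_dc => v1 v2 _.
by rewrite dc_rev; apply: eq_dc => w1 w2 _; rewrite !pairing_rev mulrC.
Qed.

End Hoffman.

(** * The power series identity exp(log(1 + X)) = 1 + X *)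

Section ExpLog.
Variables (R : realType) (N : nat).

(* The degree N truncation of log(1 + X). *)
Definition log_poly : {poly R} := 'X * \poly_(i < N) ((-1) ^+ i / i.+1%:R).

Lemma coef_log_poly i : (0 < i <= N)%N -> log_poly`_i = psi_coef R i.
Proof. by case: i => // i /andP[_ iN]; rewrite coefXM coef_poly iN. Qed.

Lemma coef0_log_poly : log_poly`_0 = 0.
Proof. by rewrite coefXM. Qed.

(** For L = log(1 + X), the equation (1 + X) L' = 1 gives (1 + X) (L^(k+1))' = (k+1) L^k; this is
    its coefficient in degree [n]. *)
Lemma log_poly_ode n k : (n < N)%N ->
  (log_poly ^+ k.+1)`_n.+1 *+ n.+1 + (log_poly ^+ k.+1)`_n *+ n
  = (log_poly ^+ k)`_n *+ k.+1.
Proof.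
(* [D] agrees with 1 only in degrees below [N], because of the truncation; hence the bound on
   [n]. *)
move=> nN; pose D := (1 + 'X) * log_poly^`().
have D_coef i : (i < N)%N -> D`_i = (i == 0%N)%:R.
  rewrite /D mulrDl mul1r coefD coefXM !coef_deriv; case: i => [|i] iN /=.
    by rewrite addr0 coef_log_poly // /psi_coef expr0 divr1.
  rewrite !coef_log_poly ?(ltnW iN) // /psi_coef /= -[X in X + _]mulr_natr.
  rewrite -[X in _ + X]mulr_natr !divfK ?pnatr_eq0 //.
  by rewrite exprS mulN1r addNr.
transitivity (((1 + 'X) * (log_poly ^+ k.+1)^`())`_n).
  rewrite mulrDl mul1r coefD coefXM !coef_deriv.
  by case: n nN => [|n] nN //=; rewrite mulr0n.
rewrite deriv_exp mulrnAr coefMn mulrA -/D coefM big_ord_recl D_coef ?(leq_ltn_trans _ nN) //.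
rewrite mul1r subn0 big1 ?addr0 // => i _.
by rewrite D_coef ?mul0r // (leq_ltn_trans _ nN) // lift0.
Qed.

(** The series E = exp(L) satisfies (1 + X) E' = E, so its coefficients obey (n+1) e_(n+1) = (1 - n)
    e_n with e_0 = 1. Any [K] above [n] will do, since L^k starts in degree k. *)
Lemma exp_log_poly K n : (n <= N)%N -> (n < K)%N ->
  \sum_(k < K) phi_coef R k * (log_poly ^+ k)`_n = (n <= 1)%:R.
Proof.
elim: n K => [|n IH] [|K] // nN nK.
  rewrite big_ord_recl big1 => [|i _].
    by rewrite /phi_coef fact0 expr0 coef1 invr1 mulr1 addr0.
  by rewrite exprS -mulrA coefXM mulr0.
apply: (@mulIf _ n.+1%:R); first by rewrite pnatr_eq0.
rewrite big_ord_recl expr0 coef1 mulr0 add0r.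
have e (k : 'I_K) : phi_coef R (lift ord0 k) * (log_poly ^+ lift ord0 k)`_n.+1 * n.+1%:R =
    phi_coef R k * (log_poly ^+ k)`_n - phi_coef R k.+1 * (log_poly ^+ k.+1)`_n * n%:R.
  rewrite lift0 -!mulrA !mulr_natr (canRL (addrK _) (log_poly_ode k nN)) mulrBr; congr (_ - _).
  rewrite -mulr_natr mulrC -mulrA mulrC; congr (_ * _).
  by rewrite /phi_coef factS natrM invfM mulVKf ?pnatr_eq0.
rewrite mulr_suml (eq_bigr _ (fun k _ => e k)) sumrB IH ?(ltnW nN) // -mulr_suml.
(* For [n = 0] the second sum is multiplied by 0. Otherwise it is the sum for [K.+1] without its
   vanishing term at k = 0. *)
have [->|n0] := posnP n; first by rewrite mulr0 subr0 mulr1.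
have := IH K.+1 (ltnW nN) (ltnW nK).
rewrite big_ord_recl expr0 coef1 -[n == 0%N]negbK -lt0n n0 mulr0 add0r => ->.
by case: n n0 {nN nK e IH} => [|[|n]] // _; rewrite ?(mul0r, subr0, mulr1, subrr).
Qed.

End ExpLog.

(** * The two Hoffman maps are mutually inverse *)

Section Inverse.
Variables (R : realType) (Al : walphabet).
Local Notation A := (letter Al).
Local Notation word := (seq A).
Implicit Types (a b : A) (u v w p q : word) (x y : wseries R Al) (c : nat -> R).

(* The Hoffman map acts on functions of the length and the bracket of a word by
   composition of power series. *)
Lemma hseries_bracket c (P : {poly R}) N K (f : nat -> R) m a u :
  P`_0 = 0 -> (forall i, (0 < i <= N)%N -> P`_i = c i) ->
  (size u <= N)%N -> (size u < K)%N ->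
  hseries c (fun w => (obr m (wbr w) == Some (Some a))%:R * f (size w)) u =
  (obr m (wbr u) == Some (Some a))%:R * \sum_(k < K) f k * (P ^+ k)`_(size u).
Proof.
move=> P0 Pc; elim: K f m u => // K IH f m u uN uK.
rewrite hseries_rec big_ord_recl expr0 coef1 mulrDr; congr (_ + _).
  have [->|u0] := eqVneq u [::]; first by rewrite !mulr1.
  by rewrite size_eq0 (negPf u0) !mulr0.
transitivity (dc (fun p q => (obr m (wbr u) == Some (Some a))%:R *
    \sum_(k < K) f k.+1 * (P`_(size p) * (P ^+ k)`_(size q))) u).
  apply: eq_dc => p q pq; rewrite /hstep.
  (* The empty prefix has no bracket, which matches the zero constant term of [P]. *)
  have [p0|p0] := eqVneq p [::].
    by rewrite p0 /= P0 big1 ?mulr0 // => k _; rewrite mul0r mulr0.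
  have pu : (size p + size q)%N = size u by rewrite -pq size_cat.
  have p1 : (0 < size p)%N by rewrite lt0n size_eq0.
  rewrite Pc ?p1 ?(leq_trans _ uN) -?pu ?leq_addr //.
  have : wbr p = Some (ibr p) by rewrite wbrE; case: (p) p0.
  case: (ibr p) => [b|] pb; last first.
    (* A prefix with bracket 0 forces the bracket of [u] to be 0. *)
    by rewrite -pq wbr_cat pb; case: m (wbr q) => [[?|]|] [[?|]|]; rewrite /= mul0r.
  (* The parameter [m] collects the brackets of the prefixes already peeled off. *)
  rewrite (_ : (fun w => _) = fun w =>
    (obr (obr m (wbr p)) (wbr w) == Some (Some a))%:R * f (size w).+1); last first.
    by apply/funext => w; rewrite wbr_cons pb obrA.
  rewrite (IH (f \o succn)); first last.
  - by move: uK; rewrite -pu ltnS; apply: leq_trans; rewrite -addn1 addnC leq_add2r.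
  - by apply: leq_trans uN; rewrite -pu leq_addl.
  rewrite -obrA -wbr_cat pq mulrCA; congr (_ * _); rewrite mulr_sumr.
  by apply: eq_bigr => k _; rewrite mulrCA.
rewrite dcZl dc_sum; congr (_ * _); apply: eq_bigr => k _.
rewrite dcZl lift0 exprS coefM; congr (_ * _); apply: eq_bigr => i _.
by rewrite size_takel ?size_drop // -ltnS.
Qed.

Lemma PsiH_phi_letter a u :
  PsiH (rcoef (hletter (phi_coef R) a)) u = (u == [:: a])%:R.
Proof.
rewrite /PsiH (_ : rcoef _ =
  fun w => (obr None (wbr w) == Some (Some a))%:R * phi_coef R (size w)); last first.
  by apply/funext => w; rewrite rcoef_hletter /= wbr_ibr.
rewrite (@hseries_bracket _ (log_poly R (size u)) (size u) (size u).+1) //.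
(* Only lengths 0 and 1 survive, and the empty word fails the bracket condition. *)
- rewrite exp_log_poly //= wbr_ibr; case: u => [|b [|b' u]] /=.
  + by rewrite mul0r.
  + by rewrite mulr1 eqseq_cons andbT.
  + by rewrite mulr0 eqseq_cons andbF.
- exact: coef0_log_poly.
- by move=> i; apply: coef_log_poly.
Qed.

(** Both sides are multiplicative in [w], which leaves the case of one letter. *)
Lemma PsiH_phi_word w u : PsiH (rcoef (hword (phi_coef R) w)) u = (u == w)%:R.
Proof.
elim: w u => [|a w IH] u.
  by rewrite (funext (@rcoef_hword_nil R Al _)) [LHS]hseries_delta_nil.
rewrite rcoef_hword_cons /PsiH hseries_tprod tprodE [u == _]eq_sym -cat1s -dc_eq_cat.
apply: eq_dc => p q _.
by rewrite [hseries _ _ p]PsiH_phi_letter [hseries _ _ q]IH [p == _]eq_sym [q == _]eq_sym.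
Qed.

Lemma PhiHK : cancel (@PhiH R Al) (@PsiH R Al).
Proof.
move=> x; apply/funext => u; rewrite -[RHS](@sum_words_wt_delta _ _ _ _ u erefl).
transitivity (\sum_(w <- words_wt Al (wword u)) x w *
    PsiH (rcoef (hword (phi_coef R) w)) u); last first.
  by apply: eq_bigr => w _; rewrite PsiH_phi_word eq_sym.
under eq_bigr => w _ do rewrite -hseriesZ.
rewrite -hseries_sum; apply: (@hseries_local _ _ _ _ _ (wword u)) => // w wu.
by rewrite /PhiH /hseries wu.
Qed.

(* In each weight, [PhiH] and [PsiH] are given by square matrices, so that a left
   inverse is also a right inverse. *)
Lemma PsiHK : cancel (@PsiH R Al) (@PhiH R Al).
Proof.
move=> x; apply/funext => u; pose W := words_wt Al (wword u).
have uW : u \in W by rewrite mem_words_wt.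
pose n := size W; pose nW (i : 'I_n) := nth [::] W i.
have sumW (F : word -> R) : \sum_(w <- W) F w = \sum_(i < n) F (nW i).
  by rewrite (big_nth [::]) big_mkord.
have nW_wt i : wword (nW i) = wword u.
  by apply/eqP; rewrite -mem_words_wt mem_nth.
have eq_nW i j : (nW i == nW j) = (i == j).
  by rewrite nth_uniq ?words_wt_uniq.
pose M c : 'M[R]_n := \matrix_(i, j) rcoef (hword c (nW i)) (nW j).
have MM : M (phi_coef R) *m M (psi_coef R) = 1%:M.
  apply/matrixP => i j; rewrite !mxE -eq_nW eq_sym -PsiH_phi_word.
  rewrite /PsiH /hseries nW_wt sumW.
  by apply: eq_bigr => k _; rewrite !mxE.
have /matrixP {}MM := mulmx1C MM.
have := uW; rewrite -index_mem => ju; pose j := Ordinal ju.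
have uj : u = nW j by rewrite /nW nth_index.
rewrite /PhiH /PsiH /hseries sumW.
under eq_bigr => i _ do rewrite nW_wt sumW mulr_suml.
rewrite exchange_big /= (bigD1 j) //= [X in _ + X]big1 => [|i ij].
  rewrite addr0 -uj -[RHS]mulr1.
  under eq_bigr => i _ do rewrite -mulrA.
  rewrite -mulr_sumr; congr (_ * _).
  have := MM j j; rewrite !mxE eqxx => e; apply: etrans e.
  by apply: eq_bigr => i _; rewrite !mxE -uj.
under eq_bigr => k _ do rewrite -mulrA.
rewrite -mulr_sumr; have := MM i j; rewrite !mxE (negPf ij).
under eq_bigr => k _ do rewrite !mxE -uj.
by move=> ->; rewrite mulr0.
Qed.

End Inverse.

(** * Adjointness: the Hoffman map turns quasi-shuffle characters into shuffle characters *)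

Section Shuffle.
Variables (R : realType) (Al : walphabet).
Local Notation A := (letter Al).
Local Notation word := (seq A).
Implicit Types (a b : A) (u v w p q : word) (x y : wseries R Al) (c : nat -> R).
Implicit Types (F G : word -> word -> R).

Definition delta w : wseries R Al := fun u => (u == w)%:R.

Lemma delta_cons a w : delta (a :: w) = tprod (delta [:: a]) (delta w).
Proof.
apply/funext => u; rewrite /delta eq_sym -cat1s -dc_eq_cat tprodE.
by apply: eq_dc => p q _; rewrite ![[:: a] == _]eq_sym [w == _]eq_sym.
Qed.

(** Concatenation on the tensor square, whose elements are series in two words; [hseries2] below is
    the tensor square of the Hoffman map. *)
Definition tprod2 F G u v : R :=
  dc (fun u1 u2 => dc (fun v1 v2 => F u1 v1 * G u2 v2) v) u.

Definition hseries2 c F u v : R := hseries c (fun w1 => hseries c (F w1) v) u.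

Lemma hseries_dc c (F : word -> word -> wseries R Al) u v :
  hseries c (fun w => dc (fun p q => F p q w) v) u = dc (fun p q => hseries c (F p q) u) v.
Proof. exact: hseries_sum. Qed.

Lemma hseries2_tprod c F G u v :
  hseries2 c (tprod2 F G) u v = tprod2 (hseries2 c F) (hseries2 c G) u v.
Proof.
have inner w : hseries c (tprod2 F G w) v = dc (fun v1 v2 =>
    dc (fun w1 w2 => hseries c (F w1) v1 * hseries c (G w2) v2) w) v.
  rewrite -exchange_dc [LHS](hseries_dc c (fun p q => tprod (F p) (G q))).
  by apply: eq_dc => p q _; rewrite hseries_tprod.
rewrite /hseries2 (funext inner).
rewrite (hseries_dc c (fun v1 v2 => tprod (fun w1 => hseries c (F w1) v1)
  (fun w2 => hseries c (G w2) v2))).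
rewrite /tprod2 exchange_dc; apply: eq_dc => p q _.
by rewrite hseries_tprod.
Qed.

(** In the recursion only the prefix equal to all of [u] contributes. *)
Lemma hseries_letter c x u : (forall w, size w != 1%N -> x w = 0) ->
  hseries c x u = if ibr u is Some b then c (size u) * x [:: b] else 0.
Proof.
move=> x0; rewrite hseries_rec x0 // mul0r add0r.
have xb b : (fun w => x (b :: w)) = fun w => x [:: b] * delta [::] w.
  apply/funext => -[|b' w]; first by rewrite /delta eqxx mulr1.
  by rewrite x0 //= mulr0.
rewrite (eq_dc (G2 := fun p q => if ibr p is Some b then
   c (size p) * (x [:: b] * (q == [::])%:R) else 0)); last first.
  by move=> p q _; rewrite /hstep; case: (ibr p) => // b; rewrite xb hseriesZ hseries_delta_nil.
rewrite dc_right ?eqxx; first by case: (ibr u) => // b; rewrite mulr1.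
by move=> p q /eqP/negPf ->; case: (ibr p) => // b; rewrite !mulr0.
Qed.

Lemma hseries_delta_letter c a u : hseries c (delta [:: a]) u = rcoef (hletter c a) u.
Proof.
rewrite hseries_letter => [|[|b [|b' w]]] //; last by rewrite /delta eqseq_cons andbF.
rewrite rcoef_hletter; case: (ibr u) => [b|]; last by rewrite mul0r.
by rewrite /delta eqseq_cons andbT mulrC.
Qed.

(** A bracket merges at most one letter of each word, so neither word gets shorter. *)
Lemma size_qshr_mem (f : A -> A -> option A) (v w s : word) :
  s \in qshr f v w -> (maxn (size v) (size w) <= size s)%N.
Proof.
elim: v w s => [|a v IHv] w s; first by rewrite inE max0n => /eqP ->.
elim: w s => [|b w IHw] s; first by rewrite inE maxn0 => /eqP ->.
rewrite [qshr _ _ _]/= !mem_cat => /or3P[/mapP[t /IHv + ->]|/mapP[t /IHw + ->]|].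
- by rewrite /= !geq_max => /andP[vt wt]; rewrite !ltnS vt ltnW.
- by rewrite /= !geq_max => /andP[vt wt]; rewrite !ltnS wt ltnW.
- case: (f a b) => // d /mapP[t /IHv + ->].
  by rewrite /= maxnSS ltnS.
Qed.

Lemma qsh_nil v : qsh v [::] = [:: v].
Proof. by rewrite /qsh qshr_nil /= revK. Qed.

Lemma nil_qsh v : qsh [::] v = [:: v].
Proof. by rewrite /qsh /= revK. Qed.

Lemma sh_nil v : sh v [::] = [:: v].
Proof. by rewrite /sh qshr_nil /= revK. Qed.

Lemma nil_sh v : sh [::] v = [:: v].
Proof. by rewrite /sh /= revK. Qed.

Lemma pairing_delta_nil (P : seq word) :
  (forall s, s \in P -> (0 < wword s)%N) -> pairing (delta [::]) P = 0.
Proof.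
move=> h; rewrite /pairing big_seq big1 // => s /h.
by rewrite /delta; case: s.
Qed.

Lemma pairing_delta_nil_qsh v w :
  pairing (delta [::]) (qsh v w) = delta [::] v * delta [::] w.
Proof.
case: v w => [|a v] w; first by rewrite nil_qsh pairing1 /delta eqxx mul1r.
rewrite {2}/delta /= mul0r pairing_delta_nil // => s /qsh_wword ->.
by rewrite wword_cons -addnA addn_gt0 wt_pos.
Qed.

Lemma pairing_delta_nil_sh v w :
  pairing (delta [::]) (sh v w) = delta [::] v * delta [::] w.
Proof.
case: v w => [|a v] w; first by rewrite nil_sh pairing1 /delta eqxx mul1r.
rewrite {2}/delta /= mul0r pairing_delta_nil // => s /sh_wword ->.
by rewrite wword_cons -addnA addn_gt0 wt_pos.
Qed.

(** The dual of the bracket, evaluated at the letter [a]: the defect of [a] from being primitive. *)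
Definition letter_br a v w : R :=
  if v is [:: b] then (if w is [:: d] then (br b d == Some a)%:R else 0) else 0.

(** A one-letter word arises in a quasi-shuffle only from that letter and the empty word, or by
    merging two letters. *)
Lemma pairing_delta_letter_qsh a v w :
  pairing (delta [:: a]) (qsh v w) =
  delta [::] w * delta [:: a] v + delta [::] v * delta [:: a] w + letter_br a v w.
Proof.
case: v => [|b v].
  by rewrite nil_qsh pairing1 /delta /= mulr0 add0r mul1r addr0.
case: w => [|d w].
  rewrite qsh_nil pairing1 (_ : letter_br _ _ _ = 0); last by case: v.
  by rewrite /delta /= mul1r mul0r !addr0.
rewrite (_ : delta [::] (d :: w) = 0) // (_ : delta [::] (b :: v) = 0) //.
rewrite !mul0r !add0r.
have long : (1 < maxn (size (b :: v)) (size (d :: w)))%N ->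
    pairing (delta [:: a]) (qsh (b :: v) (d :: w)) = 0.
  move=> l1; rewrite /pairing big_seq big1 // => s /mapP[t /size_qshr_mem + ->].
  rewrite !size_rev => /(leq_trans l1); rewrite -size_rev /delta.
  by case: (rev t) => [|? [|? ?]] //= _; rewrite eqseq_cons andbF.
case: v w long => [|b' v] [|d' w] long /=; try by rewrite long // leq_max ?orbT.
have rev1 k : rev [:: k] = [:: k] :> word by [].
have rev2 k l : rev [:: k; l] = [:: l; k] :> word by [].
rewrite pairing_rev !rev1 pairing_qshr_cons !pairing1 /delta !rev2 !eqseq_cons !andbF.
rewrite !add0r; case: (br b d) => // e.
by rewrite pairing1 rev1 eqseq_cons andbT.
Qed.

Lemma hseries2_letter_br c a u v : hseries2 c (letter_br a) u v =
  if ibr u is Some b then if ibr v is Some d then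
    c (size u) * c (size v) * (br b d == Some a)%:R else 0 else 0.
Proof.
rewrite /hseries2 hseries_letter; last first.
  move=> [|b [|b' w]] // _; rewrite /hseries big1 // => ? _; exact: mul0r.
case: (ibr u) => // b; rewrite hseries_letter => [|[|d [|d' w]]] //=.
by case: (ibr v) => [d|]; rewrite ?mulr0 // mulrA.
Qed.

(* 'C(m + n, m) / (m + n)! = 1 / (m! n!): this is where the coefficients 1 / n! matter. *)
Lemma pairing_phi_letter_sh a u v :
  pairing (rcoef (hletter (phi_coef R) a)) (sh u v) =
  hseries2 (phi_coef R) (fun w1 w2 => pairing (delta [:: a]) (qsh w1 w2)) u v.
Proof.
pose c := phi_coef R.
(* The first two terms matter only when [v] or [u] is empty, the third only when both are
   nonempty. *)
transitivity (delta [::] v * rcoef (hletter c a) u +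
    delta [::] u * rcoef (hletter c a) v + hseries2 c (letter_br a) u v); last first.
  rewrite /hseries2 -!hseries_delta_letter -[X in _ + X * _ + _](hseries_delta_nil c).
  rewrite [X in _ + X + _]mulrC -!hseriesZ -!hseriesD; congr (hseries _ _ u).
  apply/funext => w1; rewrite -[X in X * _](hseries_delta_nil c v).
  rewrite [X in X + _ + _]mulrC [X in _ + X + _]mulrC -!hseriesZ -!hseriesD; congr (hseries _ _ v).
  by apply/funext => w2; rewrite pairing_delta_letter_qsh mulrC.
rewrite hseries2_letter_br.
have [->|u0] := eqVneq u [::].
  by rewrite nil_sh pairing1 /= addr0 {2}/delta eqxx mul1r
    [X in _ * X + _]rcoef_hletter /= mul0r mulr0 add0r.
have [->|v0] := eqVneq v [::].
  rewrite sh_nil pairing1 {1}/delta eqxx mul1r {1}/delta (negPf u0) mul0r addr0.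
  by case: (ibr u) => [?|]; rewrite /= addr0.
rewrite {1 2}/delta (negPf u0) (negPf v0) !mul0r !add0r.
transitivity ((ibr (u ++ v) == Some a)%:R * (c (size u) * c (size v))).
  transitivity (\sum_(s <- sh u v) (ibr (u ++ v) == Some a)%:R * c (size u + size v)%N).
    rewrite /pairing !big_seq; apply: eq_bigr => s /sh_perm suv.
    by rewrite rcoef_hletter -wbr_ibr (wbr_perm suv) wbr_ibr (perm_size suv) size_cat.
  rewrite big_const_seq count_predT iter_addr_0 size_sh -mulrnAr; congr (_ * _).
  have := bin_fact (leq_addr (size v) (size u)); rewrite addKn => /(congr1 (fun n => n%:R : R)).
  rewrite /c /phi_coef !natrM => <-; rewrite -[LHS]mulr_natr.
  by rewrite !invfM mulrC mulVKf // pnatr_eq0 -lt0n bin_gt0 leq_addr.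
rewrite -wbr_ibr wbr_cat !wbrE; case: u u0 => // u1 u _; case: v v0 => // v1 v _.
case: (ibr (u1 :: u)) (ibr (v1 :: v)) => [b|] [d|]; rewrite /= ?mul0r //.
by rewrite mulrC.
Qed.

(** Induction on [w]: the left side factors since [sh] respects deconcatenation, the right side
    since [qsh] does and [hseries2] is multiplicative. *)
Lemma pairing_phi_word_sh w u v :
  pairing (rcoef (hword (phi_coef R) w)) (sh u v) =
  hseries2 (phi_coef R) (fun w1 w2 => pairing (delta w) (qsh w1 w2)) u v.
Proof.
elim: w u v => [|a w IH] u v.
  rewrite (_ : rcoef _ = delta [::]); last by apply/funext => s; rewrite rcoef_hword_nil.
  rewrite pairing_delta_nil_sh /hseries2 -[X in X * _](hseries_delta_nil (phi_coef R)).
  rewrite mulrC -hseriesZ; congr (hseries _ _ u); apply/funext => w1.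
  rewrite -[X in X * _](hseries_delta_nil (phi_coef R)) mulrC -hseriesZ.
  by congr (hseries _ _ v); apply/funext => w2; rewrite pairing_delta_nil_qsh.
rewrite rcoef_hword_cons [LHS]pairing_tprod_rev_qshr.
transitivity (tprod2
   (hseries2 (phi_coef R) (fun w1 w2 => pairing (delta [:: a]) (qsh w1 w2)))
   (hseries2 (phi_coef R) (fun w1 w2 => pairing (delta w) (qsh w1 w2))) u v).
  apply: eq_dc => u1 u2 _; apply: eq_dc => v1 v2 _.
  by rewrite -pairing_phi_letter_sh -IH.
rewrite -hseries2_tprod; congr (hseries2 _ _ u v).
apply/funext => w1; apply/funext => w2; rewrite [delta (a :: w)]delta_cons.
by rewrite [RHS]pairing_tprod_rev_qshr.
Qed.

Lemma hseries2_local c F G m n :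
  (forall w1 w2, wword w1 = m -> wword w2 = n -> F w1 w2 = G w1 w2) ->
  forall u v, wword u = m -> wword v = n -> hseries2 c F u v = hseries2 c G u v.
Proof.
move=> FG u v um vn; apply: hseries_local um => w wm.
by apply: hseries_local vn => w2; apply: FG.
Qed.

Lemma hseries2_sum c (I : Type) (r : seq I) (k : I -> R) (F : I -> word -> word -> R) u v :
  hseries2 c (fun w1 w2 => \sum_(i <- r) k i * F i w1 w2) u v =
  \sum_(i <- r) k i * hseries2 c (F i) u v.
Proof.
under [RHS]eq_bigr => i _ do rewrite -hseriesZ.
rewrite -hseries_sum; congr (hseries _ _ u); apply/funext => w.
by rewrite hseries_sum; apply: eq_bigr => i _; rewrite hseriesZ.
Qed.

(** Linear extension of the case of a single word. All terms of the products have the total weight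
    [n], so finitely many words enter. *)
Lemma pairing_PhiH_sh x u v : pairing (PhiH x) (sh u v) =
  hseries2 (phi_coef R) (fun w1 w2 => pairing x (qsh w1 w2)) u v.
Proof.
pose n := (wword u + wword v)%N.
transitivity (\sum_(w <- words_wt Al n) x w *
    pairing (rcoef (hword (phi_coef R) w)) (sh u v)).
  under [RHS]eq_bigr => w _ do rewrite /pairing mulr_sumr.
  rewrite exchange_big /pairing !big_seq; apply: eq_bigr => s /sh_wword sn.
  by rewrite /PhiH /hseries sn.
under eq_bigr => w _ do rewrite pairing_phi_word_sh.
rewrite -hseries2_sum; apply: (@hseries2_local _ _ _ (wword u) (wword v)) => // w1 w2 e1 e2.
under eq_bigr => w _ do rewrite /pairing mulr_sumr.
rewrite exchange_big /pairing !big_seq; apply: eq_bigr => s /qsh_wword sn.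
rewrite -[RHS](@sum_words_wt_delta _ _ _ n) /n -?e1 -?e2 //.
by apply: eq_bigr => w _; rewrite /delta eq_sym.
Qed.

Lemma PhiH_inj_local x y n : (forall u, wword u = n -> PhiH x u = PhiH y u) ->
  forall u, wword u = n -> x u = y u.
Proof.
by move=> xy u un; rewrite -(PhiHK x) -(PhiHK y); apply: hseries_local un.
Qed.

(** The tensor square of [PhiH] carries one identity to the other in each pair of weights. For the
    converse, injectivity is applied in [w] and then in [v]. *)
Lemma char_PhiH_wt x m n :
  (forall v w, wword v = m -> wword w = n -> pairing x (qsh v w) = x v * x w) <->
  (forall v w, wword v = m -> wword w = n ->
     pairing (PhiH x) (sh v w) = PhiH x v * PhiH x w).
Proof.
have xx v w : PhiH x v * PhiH x w =
    hseries2 (phi_coef R) (fun w1 w2 => x w1 * x w2) v w.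
  rewrite mulrC -hseriesZ; congr (hseries _ _ v); apply/funext => w1.
  by rewrite mulrC -hseriesZ.
split=> h v w vm wn.
  by rewrite pairing_PhiH_sh xx; exact: (hseries2_local _ h).
move: w wn; apply: (@PhiH_inj_local (fun w => pairing x (qsh v w)) (fun w => x v * x w)).
move=> w wn; move: v vm.
apply: (@PhiH_inj_local (fun v => PhiH (fun w => pairing x (qsh v w)) w)
  (fun v => PhiH (fun w => x v * x w) w)) => v vm.
by have := h v w vm wn; rewrite pairing_PhiH_sh xx.
Qed.

End Shuffle.

(** * Smoothness of the coefficients *)

Section Smooth.
Variables (R : realType) (T : R).
Implicit Types f g : R -> R.

Lemma derive1n_lin n (k : R) f g :
  (forall m t, derivable (derive1n m f) t 1) ->
  (forall m t, derivable (derive1n m g) t 1) ->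
  derive1n n (fun t => f t * k + g t) = (fun t => derive1n n f t * k + derive1n n g t).
Proof.
move=> df dg; elim: n => // n IH.
rewrite !derive1nS IH; apply/funext => t.
have -> : (fun t => derive1n n f t * k + derive1n n g t) =
      (k \*: derive1n n f) + derive1n n g.
  by apply/funext => s; rewrite mulrC.
by rewrite !derive1E deriveD ?deriveZ //=; [rewrite mulrC|exact: derivableZ].
Qed.

Lemma smooth_on_lin (k : R) f g :
  smooth_on T f -> smooth_on T g -> smooth_on T (fun t => f t * k + g t).
Proof.
move=> [f' [df ff']] [g' [dg gg']]; exists (fun t => f' t * k + g' t); split.
  move=> n t; rewrite derive1n_lin //.
  have -> : (fun t => derive1n n f' t * k + derive1n n g' t) =
      (k \*: derive1n n f') + derive1n n g'.
    by apply/funext => s; rewrite mulrC.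
  by apply: derivableD => //; exact: derivableZ.
by move=> t tT; rewrite ff' // gg'.
Qed.

Lemma smooth_on0 : smooth_on T (fun=> 0).
Proof.
exists (fun=> 0); split=> // n t.
suff -> : derive1n n (fun=> 0 : R) = fun=> 0 by exact: derivable_cst.
by elim: n => // n IH; rewrite derive1nS IH; apply/funext => s; rewrite derive1_cst.
Qed.

Lemma smooth_on_sum (I : eqType) (r : seq I) (F : I -> R -> R) (k : I -> R) :
  (forall i, i \in r -> smooth_on T (F i)) ->
  smooth_on T (fun t => \sum_(i <- r) F i t * k i).
Proof.
elim: r => [|i r IH] h.
  by rewrite (_ : (fun t => _) = fun=> 0); [exact: smooth_on0|apply/funext => t; rewrite big_nil].
rewrite (_ : (fun t => _) = fun t => F i t * k i + \sum_(j <- r) F j t * k j).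
  apply: smooth_on_lin; first by apply: h; rewrite mem_head.
  by apply: IH => j jr; apply: h; rewrite inE jr orbT.
by apply/funext => t; rewrite big_cons.
Qed.

(** Each coefficient of the image is a fixed finite linear combination of coefficients of the same
    weight. *)
Lemma smooth_on_hseries (Al : walphabet) c (X : R -> wseries R Al) n :
  (forall w, wword w = n -> smooth_on T (fun t => X t w)) ->
  forall u, wword u = n -> smooth_on T (fun t => hseries c (X t) u).
Proof.
move=> sX u un; apply: (smooth_on_sum (F := fun w t => X t w)) => w.
by rewrite mem_words_wt un => /eqP/sX.
Qed.

End Smooth.

(** * Transfer of the defining properties of rough paths and models *)

Section RoughPaths.
Variables (R : realType) (Al : walphabet) (T : R).
Implicit Types (x y : wseries R Al) (X : R -> wseries R Al) (Y : R -> R -> wseries R Al).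

Lemma charN_PhiH N x : charN (@qsh Al) N x <-> charN (@sh Al) N (PhiH x).
Proof.
split=> h v w vwN; have [hqs hsq] := char_PhiH_wt x (wword v) (wword w).
  by apply: hqs => // v' w' ev ew; apply: h; rewrite ev ew.
by apply: hsq => // v' w' ev ew; apply: h; rewrite ev ew.
Qed.

Lemma char_full_PhiH x : char_full (@qsh Al) x <-> char_full (@sh Al) (PhiH x).
Proof.
by split=> h v w; have [hqs hsq] := char_PhiH_wt x (wword v) (wword w); auto.
Qed.

Lemma hseries_neq0 c x u : hseries c x u <> 0 ->
  exists w, wword w = wword u /\ x w <> 0.
Proof.
move=> h; apply: contrapT => n0; apply: h; rewrite /hseries big_seq big1 // => w.
rewrite mem_words_wt => /eqP wu; suff -> : x w = 0 by rewrite mul0r.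
by apply: contrapT => xw; apply: n0; exists w.
Qed.

Lemma nonzeroN_PhiH N x : nonzeroN N x <-> nonzeroN N (PhiH x).
Proof.
(* Writing [x] as [PsiH (PhiH x)] lets [hseries_neq0] serve in both directions. *)
split=> -[w [wN]]; first rewrite -[x in x w]PhiHK.
  by move=> /hseries_neq0[v [vw xv]]; exists v; rewrite vw.
by move=> /hseries_neq0[v [vw xv]]; exists v; rewrite vw.
Qed.

Lemma nonzero_PhiH x : nonzero x <-> nonzero (PhiH x).
Proof.
split=> -[w]; first rewrite -[x in x w]PhiHK.
  by move=> /hseries_neq0[v [_ xv]]; exists v.
by move=> /hseries_neq0[v [_ xv]]; exists v.
Qed.

Lemma smooth_PhiH n X :
  (forall w, wword w = n -> smooth_on T (fun t => X t w)) <->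
  (forall w, wword w = n -> smooth_on T (fun t => PhiH (X t) w)).
Proof.
split=> h; first exact: smooth_on_hseries.
move=> w wn; have := smooth_on_hseries (psi_coef R) h wn.
by under eq_fun => t do rewrite [hseries _ _]PhiHK.
Qed.

(** This transfers Chen's relation: [PhiH] is multiplicative, and injective in each weight. *)
Lemma tprod_PhiH_wt n x y (z : wseries R Al) :
  (forall w, wword w = n -> tprod x y w = z w) <->
  (forall w, wword w = n -> tprod (PhiH x) (PhiH y) w = PhiH z w).
Proof.
split=> h.
  by move=> w wn; rewrite -hseries_tprod; apply: hseries_local wn.
by apply: PhiH_inj_local => w wn; rewrite -h // -hseries_tprod.
Qed.

Lemma Ngrp_PhiH N X : Nsqgrp N T X <-> Nsgrp N T (fun t => PhiH (X t)).
Proof.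
split=> -[hX sX]; split.
- by move=> t /hX[nz ch]; split; [apply: (nonzeroN_PhiH N _).1|apply: (charN_PhiH N _).1].
- move=> w wN; apply: (smooth_PhiH (wword w) X).1 => // v vw.
  by apply: sX; rewrite vw.
- by move=> t /hX[nz ch]; split; [apply: (nonzeroN_PhiH N _).2|apply: (charN_PhiH N _).2].
- move=> w wN; apply: (smooth_PhiH (wword w) X).2 => // v vw.
  by apply: sX; rewrite vw.
Qed.

Lemma grp_PhiH X : sqgrp T X <-> sgrp T (fun t => PhiH (X t)).
Proof.
split=> -[hX sX]; split.
- by move=> t /hX[nz ch]; split; [apply: (nonzero_PhiH _).1|apply: (char_full_PhiH _).1].
- by move=> w; apply: (smooth_PhiH (wword w) X).1.
- by move=> t /hX[nz ch]; split; [apply: (nonzero_PhiH _).2|apply: (char_full_PhiH _).2].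
- by move=> w; apply: (smooth_PhiH (wword w) X).2.
Qed.

Lemma Ngrm_PhiH N Y : Nsqgrm N T Y <-> Nsgrm N T (fun s t => PhiH (Y s t)).
Proof.
split=> -[hY [cY sY]]; split; [|split| |split].
- move=> s t sT tT; have [nz ch] := hY s t sT tT.
  by split; [apply: (nonzeroN_PhiH N _).1|apply: (charN_PhiH N _).1].
- move=> s u t sT uT tT w wN; apply: (tprod_PhiH_wt (wword w) _ _ _).1 => // v vw.
  by apply: cY => //; rewrite vw.
- move=> s sT w wN; apply: (smooth_PhiH (wword w) (Y s)).1 => // v vw.
  by apply: sY => //; rewrite vw.
- move=> s t sT tT; have [nz ch] := hY s t sT tT.
  by split; [apply: (nonzeroN_PhiH N _).2|apply: (charN_PhiH N _).2].
- move=> s u t sT uT tT w wN; apply: (tprod_PhiH_wt (wword w) _ _ _).2 => // v vw.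
  by apply: cY => //; rewrite vw.
- move=> s sT w wN; apply: (smooth_PhiH (wword w) (Y s)).2 => // v vw.
  by apply: sY => //; rewrite vw.
Qed.

Lemma grm_PhiH Y : sqgrm T Y <-> sgrm T (fun s t => PhiH (Y s t)).
Proof.
split=> -[hY [cY sY]]; split; [|split| |split].
- move=> s t sT tT; have [nz ch] := hY s t sT tT.
  by split; [apply: (nonzero_PhiH _).1|apply: (char_full_PhiH _).1].
- by move=> s u t sT uT tT w; apply: (tprod_PhiH_wt (wword w) _ _ _).1 => // v _; apply: cY.
- by move=> s sT w; apply: (smooth_PhiH (wword w) (Y s)).1 => // v _; apply: sY.
- move=> s t sT tT; have [nz ch] := hY s t sT tT.
  by split; [apply: (nonzero_PhiH _).2|apply: (char_full_PhiH _).2].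
- by move=> s u t sT uT tT w; apply: (tprod_PhiH_wt (wword w) _ _ _).2 => // v _; apply: cY.
- by move=> s sT w; apply: (smooth_PhiH (wword w) (Y s)).2 => // v _; apply: sY.
Qed.

Lemma PhiH_PsiH_path X : (fun t => PhiH (PsiH (X t))) = X.
Proof. by apply/funext => t; rewrite PsiHK. Qed.

Lemma PhiH_PsiH_path2 Y : (fun s t => PhiH (PsiH (Y s t))) = Y.
Proof. by apply/funext => s; apply: PhiH_PsiH_path. Qed.

End RoughPaths.

Theorem theorem3p9 (R : realType) (Al : walphabet) (T : R) :
  (* N-sqgrp vs weighted N-sgrp *)
  (forall (N : nat) (X : R -> @wseries R Al),
     (forall t, 0 <= t <= T -> in_TN N (X t)) ->
     (Nsqgrp N T X <-> Nsgrp N T (fun t => PhiH (X t)))) /\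
  (forall (N : nat) (Xh : R -> @wseries R Al),
     (forall t, 0 <= t <= T -> in_TN N (Xh t)) ->
     (Nsgrp N T Xh <-> Nsqgrp N T (fun t => PsiH (Xh t)))) /\
  (* N-sqgrm vs weighted N-sgrm *)
  (forall (N : nat) (X : R -> R -> @wseries R Al),
     (forall s t, 0 <= s <= T -> 0 <= t <= T -> in_TN N (X s t)) ->
     (Nsqgrm N T X <-> Nsgrm N T (fun s t => PhiH (X s t)))) /\
  (forall (N : nat) (Xh : R -> R -> @wseries R Al),
     (forall s t, 0 <= s <= T -> 0 <= t <= T -> in_TN N (Xh s t)) ->
     (Nsgrm N T Xh <-> Nsqgrm N T (fun s t => PsiH (Xh s t)))) /\
  (* sqgrp vs weighted sgrp *)
  (forall X : R -> @wseries R Al, sqgrp T X <-> sgrp T (fun t => PhiH (X t))) /\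
  (forall Xh : R -> @wseries R Al, sgrp T Xh <-> sqgrp T (fun t => PsiH (Xh t))) /\
  (* sqgrm vs weighted sgrm *)
  (forall X : R -> R -> @wseries R Al, sqgrm T X <-> sgrm T (fun s t => PhiH (X s t))) /\
  (forall Xh : R -> R -> @wseries R Al, sgrm T Xh <-> sqgrm T (fun s t => PsiH (Xh s t))).
Proof.
split; first by move=> N X _; exact: Ngrp_PhiH.
(* Each converse is the preceding equivalence applied to the image under [PsiH], since [PhiH] undoes
   [PsiH]. *)
split; first by move=> N X _; rewrite -{1}(PhiH_PsiH_path X) -Ngrp_PhiH.
split; first by move=> N Y _; exact: Ngrm_PhiH.
split; first by move=> N Y _; rewrite -{1}(PhiH_PsiH_path2 Y) -Ngrm_PhiH.
split; first exact: grp_PhiH.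
split; first by move=> X; rewrite -{1}(PhiH_PsiH_path X) -grp_PhiH.
split; first exact: grm_PhiH.
by move=> Y; rewrite -{1}(PhiH_PsiH_path2 Y) -grm_PhiH.
Qed.
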